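(* The assignment $X \mapsto \mathsf{C}(X)$, $f \mapsto \mathsf{C}(f)$ with $\mathsf{C}(f)(A) = f(A)^{\perp\perp}$, is a dagger-preserving functor from $\mathcal{FOS}$ to $\mathcal{caOL}$. In fact, $\mathsf{C}$ establishes a dagger equivalence between $\mathcal{FOS}$ and $\mathcal{caOL}$.
   Context: An orthoset (with $0$) is a non-empty set $X$ with a binary relation $\perp$ and element $0$ such that: $\perp$ is symmetric; $x \perp x$ iff $x=0$; $0 \perp x$ for all $x$. For $A \subseteq X$, $A^\perp = \{x : x \perp y\ \forall y \in A\}$; $\mathsf{C}(X) = \{A : A = A^{\perp\perp}\}$, a complete ortholattice. $X$ is Fréchet if for distinct nonzero $x,y$ there is $z$ with $z\perp x$, $z \not\perp y$. A map $f\colon X\to Y$ is adjointable if there is $g\colon Y\to X$ with $f(x)\perp y \iff x\perp g(y)$; for Fréchet (indeed irredundant) orthosets this adjoint is unique, denoted $f^\star$. $\mathcal{FOS}$ is the dagger category of Fréchet orthosets and adjointable maps, with dagger $f\mapsto f^\star$. A complete ortholattice $L$ is regarded as an orthoset with $a\perp b$ iff $a\le b^\perp$ and $0$ the bottom; an element of $L$ is basic if it is an atom or the bottom. $\mathcal{caOL}$ is the dagger category whose objects are complete atomistic ortholattices and whose morphisms are the maps $f\colon L\to M$ that are adjointable (as maps of orthosets) and such that both $f$ and its unique adjoint $f^\star$ send basic elements to basic elements; the dagger is $f\mapsto f^\star$. A dagger equivalence is a dagger-preserving functor that is full, faithful, and dagger essentially surjective (every object of the target is isomorphic via a morphism $u$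 with $u^\star u = \mathrm{id}$, $uu^\star=\mathrm{id}$ to an object in the image). *)

(* Defs.v *)
From HB Require Import structures.
From mathcomp Require Import all_boot all_order.
From mathcomp Require Import boolp classical_sets.

Set Implicit Arguments.
Unset Strict Implicit.
Unset Printing Implicit Defensive.

Import Order.TTheory.

Local Open Scope classical_set_scope.
Local Open Scope order_scope.

Local Obligation Tactic := idtac.

(* [comp g f] is g after f. *)
Record dagger_category := DaggerCategory {
  obj :> Type;
  hom : obj -> obj -> Type;
  idm : forall a, hom a a;
  comp : forall a b c, hom b c -> hom a b -> hom a c;
  dagger : forall a b, hom a b -> hom b a;
  compA : forall a b c d (h : hom c d) (g : hom b c) (f : hom a b),
    comp h (comp g f) = comp (comp h g) f;
  comp1m : forall a b (f : hom a b), comp (idm b) f = f;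
  compm1 : forall a b (f : hom a b), comp f (idm a) = f;
  dagger1 : forall a, dagger (idm a) = idm a;
  daggerM : forall a b c (g : hom b c) (f : hom a b),
    dagger (comp g f) = comp (dagger f) (dagger g);
  daggerK : forall a b (f : hom a b), dagger (dagger f) = f
}.

Arguments hom {_} _ _.
Arguments idm {_} _.
Arguments comp {_ _ _ _} _ _.
Arguments dagger {_ _ _} _.

Definition unitary (D : dagger_category) (a b : D) (u : hom a b) : Prop :=
  comp (dagger u) u = idm a /\ comp u (dagger u) = idm b.

Section Functors.
Variables (C D : dagger_category) (F : C -> D).
Variable F1 : forall a b : C, hom a b -> hom (F a) (F b).
Arguments F1 {_ _} _.

Record dagger_functor : Prop := DaggerFunctor {
  functor_id : forall a : C, F1 (idm a) = idm (F a);
  functor_comp : forall (a b c : C) (g : hom b c) (f : hom a b),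
    F1 (comp g f) = comp (F1 g) (F1 f);
  functor_dagger : forall (a b : C) (f : hom a b),
    F1 (dagger f) = dagger (F1 f)
}.

Definition full : Prop :=
  forall (a b : C) (g : hom (F a) (F b)), exists f : hom a b, F1 f = g.

Definition faithful : Prop :=
  forall (a b : C) (f f' : hom a b), F1 f = F1 f' -> f = f'.

Definition dagger_essentially_surjective : Prop :=
  forall d : D, exists (c : C) (u : hom (F c) d), unitary u.

Definition dagger_equivalence : Prop :=
  [/\ dagger_functor, full, faithful & dagger_essentially_surjective].

End Functors.

Arguments dagger_functor {C D} F F1.
Arguments dagger_equivalence {C D} F F1.

HB.mixin Record isOrthoset X := {
  perp : X -> X -> Prop;
  ozero : X;
  perp_sym : forall x y, perp x y -> perp y x;
  perpxx : forall x, perp x x <-> x = ozero;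
  perp0x : forall x, perp ozero x
}.

#[short(type="orthosetType")]
HB.structure Definition Orthoset := { X of isOrthoset X }.

Definition frechet (X : orthosetType) : Prop :=
  forall x y : X, x <> ozero -> y <> ozero -> x <> y ->
  exists z : X, perp z x /\ ~ perp z y.

Section Adjoints.
Variables X Y : orthosetType.
Implicit Types (f : X -> Y) (g : Y -> X).

Definition is_adjoint f g : Prop :=
  forall x y, perp (f x) y <-> perp x (g y).

Definition adjointable f : Prop := exists g, is_adjoint f g.

(* Meaningful only for adjointable [f] on an irredundant [X], where the adjoint
   is unique (see [adjointE]). *)
Definition adjoint f : Y -> X :=
  if pselect (adjointable f) is left fP then projT1 (cid fP)
  else fun=> ozero.

Lemma adjointP f : adjointable f -> is_adjoint f (adjoint f).
Proof. by rewrite /adjoint; case: pselect => // fP _; case: cid. Qed.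

End Adjoints.

Definition irredundant (X : orthosetType) : Prop :=
  forall x y : X, (forall z, perp z x <-> perp z y) -> x = y.

Lemma frechet_irredundant (X : orthosetType) : frechet X -> irredundant X.
Proof.
move=> frX x y xy.
have [x0|x0] := pselect (x = ozero).
  by rewrite x0; apply/esym/perpxx/xy; rewrite x0; apply/perp_sym/perp0x.
have [y0|y0] := pselect (y = ozero).
  by rewrite y0; apply/perpxx/xy; rewrite y0; apply/perp_sym/perp0x.
have [//|nxy] := pselect (x = y).
by have [z [zx []]] := frX x y x0 y0 nxy; apply/xy.
Qed.

Lemma is_adjoint_sym (X Y : orthosetType) (f : X -> Y) g :
  is_adjoint f g -> is_adjoint g f.
Proof.
by move=> fg y x; split => /perp_sym h; apply: perp_sym; apply/fg.
Qed.

Lemma is_adjoint_id (X : orthosetType) : is_adjoint (@idfun X) idfun.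
Proof. by move=> x y. Qed.

Lemma is_adjoint_comp (X Y Z : orthosetType) (g : Y -> Z) (f : X -> Y) g' f' :
  is_adjoint g g' -> is_adjoint f f' -> is_adjoint (g \o f) (f' \o g').
Proof. by move=> gP fP x z /=; rewrite gP fP. Qed.

Lemma adjointE (X Y : orthosetType) (f : X -> Y) g :
  irredundant X -> is_adjoint f g -> adjoint f = g.
Proof.
move=> irrX fg; apply/funext => y; apply: irrX => x.
have fP : adjointable f by exists g.
by rewrite -fg -(adjointP fP).
Qed.

Lemma adjointable_adjoint (X Y : orthosetType) (f : X -> Y) :
  adjointable f -> adjointable (adjoint f).
Proof. by move=> fP; exists f; apply/is_adjoint_sym/adjointP. Qed.

Lemma adjointK (X Y : orthosetType) (f : X -> Y) :
  irredundant Y -> adjointable f -> adjoint (adjoint f) = f.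
Proof. by move=> irrY fP; apply/adjointE => //; apply/is_adjoint_sym/adjointP. Qed.

Record fos_obj := FosObj {
  fos_sort :> orthosetType;
  fos_frechet : frechet fos_sort
}.

Record fos_hom (X Y : fos_obj) := FosHom {
  fos_fun :> X -> Y;
  fos_adjointable : adjointable fos_fun
}.

Lemma fos_homP (X Y : fos_obj) (f g : fos_hom X Y) :
  fos_fun f = fos_fun g -> f = g.
Proof.
by case: f g => [f fP] [g gP] /= fg; subst g; rewrite (Prop_irrelevance fP gP).
Qed.

Lemma fos_irredundant (X : fos_obj) : irredundant X.
Proof. exact/frechet_irredundant/fos_frechet. Qed.

Definition fos_id (X : fos_obj) : fos_hom X X :=
  FosHom (ex_intro _ _ (@is_adjoint_id X)).

Definition fos_comp (X Y Z : fos_obj) (g : fos_hom Y Z) (f : fos_hom X Y) :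
  fos_hom X Z :=
  FosHom (ex_intro _ _ (is_adjoint_comp (adjointP (fos_adjointable g))
                                        (adjointP (fos_adjointable f)))).

Definition fos_dagger (X Y : fos_obj) (f : fos_hom X Y) : fos_hom Y X :=
  FosHom (adjointable_adjoint (fos_adjointable f)).

Program Definition FOS : dagger_category :=
  @DaggerCategory fos_obj fos_hom fos_id fos_comp fos_dagger _ _ _ _ _ _.
Next Obligation. by move=> *; apply: fos_homP. Qed.
Next Obligation. by move=> *; apply: fos_homP. Qed.
Next Obligation. by move=> *; apply: fos_homP. Qed.
Next Obligation.
move=> X; apply/fos_homP/adjointE; first exact: fos_irredundant.
exact: is_adjoint_id.
Qed.
Next Obligation.
move=> X Y Z g f; apply/fos_homP/adjointE; first exact: fos_irredundant.
by apply: is_adjoint_comp; apply/adjointP/fos_adjointable.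
Qed.
Next Obligation.
move=> X Y f; apply/fos_homP/adjointK; first exact: fos_irredundant.
exact: fos_adjointable.
Qed.

HB.mixin Record hasOrthocomplement d L of Order.TBLattice d L := {
  ocompl : L -> L;
  ocomplK : involutive ocompl;
  le_ocompl : forall x y : L, x <= y -> ocompl y <= ocompl x;
  meet_ocompl : forall x : L, x `&` ocompl x = \bot;
  join_ocompl : forall x : L, x `|` ocompl x = \top
}.

#[short(type="ortholatticeType")]
HB.structure Definition Ortholattice d :=
  { L of Order.TBLattice d L & hasOrthocomplement d L }.

HB.mixin Record isComplete d L of Order.Lattice d L := {
  ex_supremum : forall A : set L, supremums A !=set0;
  ex_infimum : forall A : set L, infimums A !=set0
}.

#[short(type="completeOrtholatticeType")]
HB.structure Definition CompleteOrtholattice d :=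
  { L of Ortholattice d L & isComplete d L }.

Section Atoms.
Variables (d : Order.disp_t) (L : tbLatticeType d).

Definition atom (a : L) : Prop :=
  a <> \bot /\ forall b : L, b <= a -> b = \bot \/ b = a.

Definition basic (a : L) : Prop := atom a \/ a = \bot.

Definition atomistic : Prop :=
  forall x : L, exists A : set L, A `<=` atom /\ supremums A x.

End Atoms.

Definition orthoset_of d (L : ortholatticeType d) : Type := L.

Section OrthosetOf.
Variables (d : Order.disp_t) (L : ortholatticeType d).
Implicit Types x y : L.

Definition lperp x y : Prop := x <= ocompl y.

Lemma lperp_sym x y : lperp x y -> lperp y x.
Proof. by move=> /le_ocompl; rewrite ocomplK. Qed.

Lemma lperpxx x : lperp x x <-> x = \bot.
Proof.
split=> [xx|->]; last exact: le0x.
by apply/le_anti; rewrite le0x andbT -(meet_ocompl x) lexI lexx.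
Qed.

Lemma lperp0x x : lperp \bot x.
Proof. exact: le0x. Qed.

HB.instance Definition _ :=
  isOrthoset.Build (orthoset_of L) lperp_sym lperpxx lperp0x.

Lemma orthoset_of_irredundant : irredundant (orthoset_of L).
Proof.
move=> x y xy; have h z : ((z : L) <= ocompl x) <-> (z <= ocompl y) := xy z.
apply: (inv_inj (@ocomplK _ L)); apply/le_anti.
by apply/andP; split; [apply/h|apply/h].
Qed.

End OrthosetOf.

(* Displays only select notations; all objects are given the same one. *)
Fact ortho_display : Order.disp_t. Proof. by []. Qed.

Record caol_obj := CaolObj {
  caol_sort :> completeOrtholatticeType ortho_display;
  caol_atomistic : atomistic caol_sort
}.

Section CaolMap.
Variables (d d' : Order.disp_t) (L : ortholatticeType d).
Variable (M : ortholatticeType d').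

Definition preserves_basic (f : L -> M) : Prop :=
  forall a : L, basic a -> basic (f a).

Definition ladjointable (f : L -> M) : Prop :=
  adjointable (f : orthoset_of L -> orthoset_of M).

Definition ladjoint (f : L -> M) : M -> L :=
  adjoint (f : orthoset_of L -> orthoset_of M).

End CaolMap.

Definition caol_map d d' (L : ortholatticeType d) (M : ortholatticeType d')
    (f : L -> M) : Prop :=
  [/\ ladjointable f, preserves_basic f & preserves_basic (ladjoint f)].

Record caol_hom (L M : caol_obj) := CaolHom {
  caol_fun :> L -> M;
  caol_homP : caol_map caol_fun
}.

Lemma caol_hom_inj (L M : caol_obj) (f g : caol_hom L M) :
  caol_fun f = caol_fun g -> f = g.
Proof.
by case: f g => [f fP] [g gP] /= fg; subst g; rewrite (Prop_irrelevance fP gP).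
Qed.

Section CaolMapTheory.
Variable d : Order.disp_t.
Implicit Types L M N : ortholatticeType d.

Lemma ladjointE L M (f : L -> M) g :
  is_adjoint (f : orthoset_of L -> orthoset_of M) g -> ladjoint f = g.
Proof. exact/adjointE/orthoset_of_irredundant. Qed.

Lemma ladjoint_id L : ladjoint (@idfun L) = idfun.
Proof. exact/ladjointE/is_adjoint_id. Qed.

Lemma ladjoint_comp L M N (g : M -> N) (f : L -> M) :
  ladjointable g -> ladjointable f ->
  ladjoint (g \o f) = ladjoint f \o ladjoint g.
Proof.
by move=> gP fP; apply/ladjointE/is_adjoint_comp; apply/adjointP.
Qed.

Lemma ladjointK L M (f : L -> M) :
  ladjointable f -> ladjoint (ladjoint f) = f.
Proof. exact/adjointK/orthoset_of_irredundant. Qed.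

Lemma caol_map_id L : caol_map (@idfun L).
Proof.
split=> //; last by rewrite ladjoint_id.
by exists idfun; apply: is_adjoint_id.
Qed.

Lemma caol_map_comp L M N (g : M -> N) (f : L -> M) :
  caol_map g -> caol_map f -> caol_map (g \o f).
Proof.
move=> [g1 g2 g3] [f1 f2 f3]; split.
- by exists (ladjoint f \o ladjoint g); apply: is_adjoint_comp; apply/adjointP.
- by move=> a /f2/g2.
- by rewrite ladjoint_comp// => a /g3/f3.
Qed.

Lemma caol_map_ladjoint L M (f : L -> M) :
  caol_map f -> caol_map (ladjoint f).
Proof.
by case=> f1 f2 f3; split; rewrite ?ladjointK//; apply: adjointable_adjoint.
Qed.

End CaolMapTheory.

Definition caol_id (L : caol_obj) : caol_hom L L := CaolHom (caol_map_id L).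

Definition caol_comp (L M N : caol_obj) (g : caol_hom M N) (f : caol_hom L M) :
  caol_hom L N := CaolHom (caol_map_comp (caol_homP g) (caol_homP f)).

Definition caol_dagger (L M : caol_obj) (f : caol_hom L M) : caol_hom M L :=
  CaolHom (caol_map_ladjoint (caol_homP f)).

Program Definition caOL : dagger_category :=
  @DaggerCategory caol_obj caol_hom caol_id caol_comp caol_dagger _ _ _ _ _ _.
Next Obligation. by move=> *; apply: caol_hom_inj. Qed.
Next Obligation. by move=> *; apply: caol_hom_inj. Qed.
Next Obligation. by move=> *; apply: caol_hom_inj. Qed.
Next Obligation. by move=> L; apply/caol_hom_inj/ladjoint_id. Qed.
Next Obligation.
move=> L M N g f; apply/caol_hom_inj/ladjoint_comp.
  by case: (caol_homP g).
by case: (caol_homP f).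
Qed.
Next Obligation.
by move=> L M f; apply/caol_hom_inj/ladjointK; case: (caol_homP f).
Qed.

Section Orthocomplement.
Variable X : orthosetType.
Implicit Types A B : set X.

Definition orthocomp A : set X := [set x | forall y, A y -> perp x y].

Definition biorth A : set X := orthocomp (orthocomp A).

Lemma sub_biorth A : A `<=` biorth A.
Proof. by move=> x Ax y; move=> /(_ x Ax)/perp_sym. Qed.

Lemma orthocompS A B : A `<=` B -> orthocomp B `<=` orthocomp A.
Proof. by move=> AB x Bx y /AB/Bx. Qed.

Lemma orthocomp3 A : biorth (orthocomp A) = orthocomp A.
Proof.
rewrite eqEsubset; split; last exact: sub_biorth.
exact/orthocompS/sub_biorth.
Qed.

Lemma biorthS A B : A `<=` B -> biorth A `<=` biorth B.
Proof. by move=> AB; apply/orthocompS/orthocompS. Qed.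

Lemma orthocompI A : (A `&` orthocomp A)%classic `<=` [set ozero].
Proof. by move=> x [Ax /(_ x Ax)/perpxx]. Qed.

Lemma orthocompT : orthocomp [set: X] = [set ozero].
Proof.
rewrite eqEsubset; split=> [x /(_ x I)/perpxx //|_ -> y _]; exact: perp0x.
Qed.

Lemma orthocomp1 : orthocomp [set ozero : X] = setT.
Proof. by rewrite -subTset => x _ _ ->; apply/perp_sym/perp0x. Qed.

End Orthocomplement.

Record orthoclosed (X : orthosetType) := Orthoclosed {
  orthoclosed_set :> set X;
  orthoclosed_setP : biorth orthoclosed_set == orthoclosed_set
}.

HB.instance Definition _ (X : orthosetType) :=
  [isSub for @orthoclosed_set X].
HB.instance Definition _ (X : orthosetType) :=
  [Choice of orthoclosed X by <:].
HB.instance Definition _ (X : orthosetType) :=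
  [SubChoice_isSubPOrder of orthoclosed X by <: with ortho_display].

Section OrthoclosedLattice.
Variable X : orthosetType.
Implicit Types A B C : orthoclosed X.

Lemma orthoclosedE A : biorth A = A.
Proof. exact/eqP/orthoclosed_setP. Qed.

Lemma orthoclosed_inj A B : A = B :> set X -> A = B.
Proof. exact: val_inj. Qed.

Lemma orthoclosed_leP A B : reflect (A `<=` B) (A <= B).
Proof. by rewrite leEsub; apply: (iffP idP) => /subsetPset. Qed.

Fact biorth_closed (S : set X) : biorth (biorth S) == biorth S.
Proof. exact/eqP/orthocomp3. Qed.

Definition orthoclosure (S : set X) : orthoclosed X :=
  Orthoclosed (biorth_closed S).

Lemma orthoclosure_min (S : set X) A :
  reflect (S `<=` A) (orthoclosure S <= A).
Proof.
apply: (iffP (orthoclosed_leP _ _)) => [SA x /sub_biorth/SA //|SA].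
by rewrite -(orthoclosedE A); apply: biorthS.
Qed.

Fact orthocomp_closed (S : set X) : biorth (orthocomp S) == orthocomp S.
Proof. exact/eqP/orthocomp3. Qed.

Definition orthoclosed_compl A : orthoclosed X :=
  Orthoclosed (orthocomp_closed A).

Fact bigcap_closed (F : set (orthoclosed X)) :
  biorth (\bigcap_(A in F) A) == \bigcap_(A in F) A.
Proof.
apply/eqP; rewrite eqEsubset; split; last exact: sub_biorth.
move=> x xF A FA; rewrite -(orthoclosedE A); move: x xF.
by apply: biorthS => x; apply.
Qed.

Fact setI_closed A B : biorth (A `&` B)%classic == (A `&` B)%classic.
Proof.
apply/eqP; rewrite eqEsubset; split; last exact: sub_biorth.
by move=> x xAB; split; [rewrite -(orthoclosedE A)|rewrite -(orthoclosedE B)];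
  move: x xAB; apply: biorthS => x [].
Qed.

Definition orthoclosed_meet A B : orthoclosed X :=
  Orthoclosed (setI_closed A B).

Definition orthoclosed_join A B : orthoclosed X := orthoclosure (A `|` B)%classic.

Fact orthoclosed_meetP A B C :
  (A <= orthoclosed_meet B C) = (A <= B) && (A <= C).
Proof.
apply/orthoclosed_leP/andP => [|[/orthoclosed_leP AB /orthoclosed_leP AC]].
  by rewrite subsetI => -[AB AC]; split; apply/orthoclosed_leP.
by rewrite subsetI.
Qed.

Fact orthoclosed_joinP A B C :
  (orthoclosed_join A B <= C) = (A <= C) && (B <= C).
Proof.
apply/orthoclosure_min/andP => [|[/orthoclosed_leP AC /orthoclosed_leP BC]].
  by rewrite subUset => -[AC BC]; split; apply/orthoclosed_leP.
by rewrite subUset.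
Qed.

HB.instance Definition _ :=
  Order.POrder_MeetJoin_isLattice.Build ortho_display (orthoclosed X)
    orthoclosed_meetP orthoclosed_joinP.

Fact set0_closed : biorth [set ozero : X] == [set ozero].
Proof. by rewrite /biorth orthocomp1 orthocompT. Qed.

Fact setT_closed : biorth [set: X] == setT.
Proof. by rewrite /biorth orthocompT orthocomp1. Qed.

Fact orthoclosed_le0x A : Orthoclosed set0_closed <= A.
Proof.
apply/orthoclosed_leP => _ -> /=.
by rewrite -(orthoclosedE A) => y _; apply: perp0x.
Qed.

Fact orthoclosed_lex1 A : A <= Orthoclosed setT_closed.
Proof. by apply/orthoclosed_leP. Qed.

HB.instance Definition _ :=
  Order.hasBottom.Build ortho_display (orthoclosed X) orthoclosed_le0x.
HB.instance Definition _ :=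
  Order.hasTop.Build ortho_display (orthoclosed X) orthoclosed_lex1.

Fact orthoclosed_complK : involutive orthoclosed_compl.
Proof. by move=> A; apply/orthoclosed_inj/orthoclosedE. Qed.

Fact orthoclosed_le_compl A B :
  A <= B -> orthoclosed_compl B <= orthoclosed_compl A.
Proof. by move=> /orthoclosed_leP AB; apply/orthoclosed_leP/orthocompS. Qed.

Fact orthoclosed_meet_compl A : A `&` orthoclosed_compl A = \bot.
Proof.
apply/le_anti; rewrite le0x andbT.
by apply/orthoclosed_leP => x; apply: orthocompI.
Qed.

Fact orthoclosed_join_compl A : A `|` orthoclosed_compl A = \top.
Proof.
rewrite -[LHS]orthoclosed_complK -[RHS]orthoclosed_complK; congr (_ _).
have -> : orthoclosed_compl \top = \bot.
  by apply/orthoclosed_inj/orthocompT.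
apply/le_anti; rewrite le0x andbT.
rewrite -(orthoclosed_meet_compl (orthoclosed_compl A)) lexI orthoclosed_complK.
apply/andP; split; last rewrite -[leRHS]orthoclosed_complK;
  by apply: orthoclosed_le_compl; rewrite (leUl, leUr).
Qed.

HB.instance Definition _ :=
  hasOrthocomplement.Build ortho_display (orthoclosed X)
    orthoclosed_complK orthoclosed_le_compl
    orthoclosed_meet_compl orthoclosed_join_compl.

Fact orthoclosed_supremum (F : set (orthoclosed X)) : supremums F !=set0.
Proof.
exists (orthoclosure (\bigcup_(A in F) A)); split=> [A FA|B FB].
  by apply/orthoclosed_leP => x Ax; apply: sub_biorth; exists A.
by apply/orthoclosure_min => x [A /FB/orthoclosed_leP]; apply.
Qed.

Fact orthoclosed_infimum (F : set (orthoclosed X)) : infimums F !=set0.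
Proof.
exists (Orthoclosed (bigcap_closed F)); split=> [A FA|B FB].
  by apply/orthoclosed_leP => x; apply.
by apply/orthoclosed_leP => x Bx A /FB/orthoclosed_leP; apply.
Qed.

HB.instance Definition _ :=
  isComplete.Build ortho_display (orthoclosed X)
    orthoclosed_supremum orthoclosed_infimum.

End OrthoclosedLattice.

Definition orthoclosed_map (X Y : orthosetType) (f : X -> Y)
  (A : orthoclosed X) : orthoclosed Y := orthoclosure (f @` A).

(* That C(X) is atomistic and that C(f) is a morphism of caOL are left as
   arguments, to be proved together with functoriality. *)
Definition C_obj (CatomP : forall X : fos_obj, atomistic (orthoclosed X))
  (X : FOS) : caOL := CaolObj (@CatomP X).

Definition C_hom (CatomP : forall X : fos_obj, atomistic (orthoclosed X))
  (CmapP : forall (X Y : fos_obj) (f : fos_hom X Y),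
    caol_map (orthoclosed_map f))
  (X Y : FOS) (f : hom X Y) : hom (C_obj CatomP X) (C_obj CatomP Y) :=
  @CaolHom (C_obj CatomP X) (C_obj CatomP Y)
    (orthoclosed_map (f : fos_hom X Y)) (@CmapP X Y f).

(* Main.v *)
(* In a Fréchet orthoset the closure of a singleton {x} is {0, x}; hence the
   basic elements of C(X) are exactly these closures, and x -> {x}^⊥⊥ embeds X
   into C(X), preserving and reflecting orthogonality.  Since A^⊥ consists of
   the x such that A is orthogonal to {x}^⊥⊥, an adjointable map into C(Y) is
   determined by its adjoint on basic elements, which gives fullness and
   faithfulness.  For essential surjectivity, a complete atomistic ortholattice
   L is recovered from the orthoset of its basic elements by A -> sup A, whose
   adjoint and inverse sends l to the set of basic elements below l. *)
Require Import Defs.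
From HB Require Import structures.
From mathcomp Require Import all_boot all_order.
From mathcomp Require Import boolp classical_sets.

Set Implicit Arguments.
Unset Strict Implicit.
Unset Printing Implicit Defensive.

Import Order.TTheory.

Local Open Scope classical_set_scope.
Local Open Scope order_scope.

(** * Closures of singletons in an arbitrary orthoset *)

Section Points.
Variable X : orthosetType.
Implicit Types (x y : X) (A B : orthoclosed X).

Definition point x : orthoclosed X := orthoclosure [set x].

Lemma point_le x A : (point x <= A) <-> orthoclosed_set A x.
Proof.
split=> [/orthoclosure_min|Ax]; first exact.
by apply/orthoclosure_min => _ ->.
Qed.

Lemma mem_point x : orthoclosed_set (point x) x.
Proof. exact/point_le. Qed.

Lemma orthocomp_point x : orthocomp (point x) = [set y | perp y x].
Proof.
rewrite [LHS]orthocomp3; apply/seteqP.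
by split=> [y yx|y yx _ -> //]; apply: yx.
Qed.

(** Lets a closed set be recovered from its orthogonality to points, since it is determined by its
    orthocomplement. *)
Lemma lperp_point A y : lperp A (point y) <-> orthocomp A y.
Proof.
split=> [/orthoclosed_leP Ay x /Ay|Ay].
  by rewrite [X in X _ -> _]orthocomp_point => /perp_sym.
apply/orthoclosed_leP => x /Ay/perp_sym.
by rewrite [X in _ -> X _]orthocomp_point.
Qed.

Lemma lperp_points x y : lperp (point x) (point y) <-> perp x y.
Proof.
rewrite lperp_point orthocomp_point /=.
by split=> /perp_sym.
Qed.

Lemma orthoclosed0 A : orthoclosed_set A ozero.
Proof. by rewrite -(orthoclosedE A) => y _; apply: perp0x. Qed.

Lemma orthoclosed_botE A : A = \bot <-> A `<=` [set ozero].
Proof.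
split=> [-> //|A0]; apply/le_anti; rewrite le0x andbT.
exact/orthoclosed_leP.
Qed.

Lemma point0 : point ozero = \bot.
Proof. by apply/le_anti; rewrite le0x andbT; apply/point_le. Qed.

Lemma orthocomp_inj A B : orthocomp A = orthocomp B -> A = B.
Proof.
move=> AB; apply/orthoclosed_inj.
by rewrite -(orthoclosedE A) -(orthoclosedE B) /biorth AB.
Qed.

End Points.

(** * Basic elements of the lattice of a Fréchet orthoset *)

Section FrechetPoints.
Variables (X : orthosetType) (frX : frechet X).
Implicit Types (x y : X) (A B : orthoclosed X).

(** Otherwise some [z] is orthogonal to [x] but not to [y], whereas [y] in the closure of [x] is
    orthogonal to everything orthogonal to [x]. *)
Lemma frechet_point x y : orthoclosed_set (point x) y -> y = ozero \/ y = x.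
Proof.
move=> xy; have [|y0] := pselect (y = ozero); [by left|right].
have [x0|x0] := pselect (x = ozero).
  by move: xy; rewrite x0 point0.
have [//|nxy] := pselect (y = x).
have [z [zx []]] := frX x0 y0 (fun e => nxy (esym e)).
by apply/perp_sym/xy => _ ->.
Qed.

Lemma point_inj : injective (@point X).
Proof.
move=> x y xy.
(* Membership of [x] in [point y] leaves only [x = ozero] open; the reverse membership then settles
   [y]. *)
have [x0|//] : x = ozero \/ x = y.
  by apply: frechet_point; rewrite -xy; apply/point_le.
suff [->|->] : y = ozero \/ y = x by [].
by apply: frechet_point; rewrite xy; apply/point_le.
Qed.

Lemma point_atom x : x <> ozero -> atom (point x).
Proof.
move=> x0; split=> [/orthoclosed_botE/(_ x (@mem_point X x))/x0//|B Bx].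
have [Bx'|nBx] := pselect (orthoclosed_set B x).
  by right; apply/le_anti; rewrite Bx; apply/point_le.
left; apply/orthoclosed_botE => y By.
have /orthoclosed_leP/(_ _ By)/frechet_point[//|yx] := Bx.
by rewrite yx in By.
Qed.

Lemma basicP A : basic A <-> exists x, A = point x.
Proof.
split=> [[[A0 Amin]|->]|[x ->]]; last 2 first.
- by exists ozero; rewrite point0.
- have [->|x0] := pselect (x = ozero); first by right; apply: point0.
  by left; apply: point_atom.
(* An atom contains a nonzero [x], and minimality forces it to equal [point x]. *)
have [x [Ax x0]] : exists x, orthoclosed_set A x /\ x <> ozero.
  apply: contra_notP A0 => nA; apply/orthoclosed_botE => x Ax /=.
  by apply: contra_notP nA => x0; exists x.
have /Amin[|<-] : point x <= A by apply/point_le.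
  by move=> /orthoclosed_botE/(_ x (@mem_point X x))/x0.
by exists x.
Qed.

Lemma orthoclosed_atomistic : atomistic (orthoclosed X).
Proof.
move=> A; exists [set B | atom B /\ B <= A]; split=> [B []//|].
split=> [B [] //|B AB]; apply/orthoclosed_leP => x Ax.
have [->|x0] := pselect (x = ozero); first exact: orthoclosed0.
apply/point_le/AB; split; first exact: point_atom.
exact/point_le.
Qed.

End FrechetPoints.

(** * The action on adjointable maps *)

Section Functor.
Variables (X Y : orthosetType) (f : X -> Y) (g : Y -> X).
Hypothesis fg : is_adjoint f g.

Lemma image_biorth (S : set X) : f @` biorth S `<=` biorth (f @` S).
Proof.
move=> _ [x Sx <-] y fSy; apply/fg/Sx => s Ss.
by apply/perp_sym/fg/perp_sym/fSy; exists s.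
Qed.

Lemma orthoclosed_map_closure (S : set X) :
  orthoclosed_map f (orthoclosure S) = orthoclosure (f @` S).
Proof.
apply/le_anti/andP; split; apply/orthoclosure_min.
  exact: image_biorth.
by move=> _ [x Sx <-]; apply/sub_biorth; exists x => //; apply/sub_biorth.
Qed.

Lemma orthoclosed_map_point x : orthoclosed_map f (point x) = point (f x).
Proof. by rewrite orthoclosed_map_closure image_set1. Qed.

(** Closures do not affect orthogonality, so both sides say that [f x] is orthogonal to [y] for all
    [x] in [A] and [y] in [B]. *)
Lemma orthoclosed_map_adjoint :
  is_adjoint (orthoclosed_map f : orthoset_of _ -> orthoset_of _)
             (orthoclosed_map g).
Proof.
move=> A B; rewrite /perp/= /lperp/=; split.
  move=> /orthoclosure_min AB.
  apply: lperp_sym; apply/orthoclosure_min => _ [y By <-] x Ax.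
  apply/perp_sym/fg.
  by apply: AB => //; exists x.
move=> /lperp_sym/orthoclosure_min BA.
apply/orthoclosure_min => _ [x Ax <-] y By.
by apply/fg/perp_sym/BA => //; exists y.
Qed.

End Functor.

Lemma ladjoint_orthoclosed_map (X Y : orthosetType) (f : X -> Y) :
  adjointable f ->
  ladjoint (orthoclosed_map f) = orthoclosed_map (adjoint f).
Proof. by move=> fP; apply/ladjointE/orthoclosed_map_adjoint/adjointP. Qed.

Lemma orthoclosed_map_basic (X Y : orthosetType) (f : X -> Y) :
  frechet X -> frechet Y -> adjointable f -> preserves_basic (orthoclosed_map f).
Proof.
move=> frX frY [g fg] A /(basicP frX)[x ->].
by apply/(basicP frY); exists (f x); apply: orthoclosed_map_point fg _.
Qed.

Lemma orthoclosed_map_caol (X Y : fos_obj) (f : fos_hom X Y) :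
  caol_map (orthoclosed_map f).
Proof.
have fP := fos_adjointable f.
have [frX frY] := (@fos_frechet X, @fos_frechet Y).
split; last rewrite ladjoint_orthoclosed_map//.
- by exists (orthoclosed_map (adjoint f)); apply/orthoclosed_map_adjoint/adjointP.
- exact: orthoclosed_map_basic.
- exact/orthoclosed_map_basic/adjointable_adjoint.
Qed.

(** * Fullness: morphisms are induced by their action on points *)

Section Fullness.
Variables (X Y : orthosetType) (frX : frechet X) (frY : frechet Y).
Variable h : orthoclosed X -> orthoclosed Y.

Lemma caol_map_orthoclosed_map :
  caol_map h -> exists f : X -> Y, adjointable f /\ orthoclosed_map f = h.
Proof.
move=> [/adjointP hP hb hb'].
have /choice[f fE] x : exists y, h (point x) = point y.
  by apply/(basicP frY)/hb/(basicP frX); exists x.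
have /choice[g gE] y : exists x, ladjoint h (point y) = point x.
  by apply/(basicP frX)/hb'/(basicP frY); exists y.
(* Points reflect orthogonality, so the adjunction of [h] restricts to one between [f] and [g]. *)
have fg : is_adjoint f g.
  by move=> x y; rewrite -!lperp_points -fE -gE; apply: hP.
exists f; split; first by exists g.
(* Complements are compared at each [y]: for both maps, membership means that [A] is orthogonal to
   [point (g y)]. *)
apply/funext => A; apply/orthocomp_inj/seteqP.
have E y : orthocomp (orthoclosed_map f A) y <-> orthocomp (h A) y.
  rewrite -!lperp_point.
  have -> : lperp (h A) (point y) <-> lperp A (point (g y)).
    by rewrite -gE; apply: hP.
  rewrite -(orthoclosed_map_point (is_adjoint_sym fg)).
  exact: (orthoclosed_map_adjoint fg).
by split=> y /E.
Qed.

End Fullness.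

(** * The orthoset of basic elements of an atomistic ortholattice *)

Section BasicOrthoset.
Variables (d : Order.disp_t) (L : ortholatticeType d).

Definition basic_elt : Type := {a : L | basic a}.

Definition basic_perp (a b : basic_elt) : Prop := lperp (sval a) (sval b).

Definition basic_bot : basic_elt := exist _ \bot (or_intror erefl).

Fact basic_perp_sym a b : basic_perp a b -> basic_perp b a.
Proof. exact: lperp_sym. Qed.

Lemma basic_elt_inj (a b : basic_elt) : sval a = sval b -> a = b.
Proof. exact: eq_sig_hprop (fun=> @Prop_irrelevance _) a b. Qed.

Fact basic_perpxx a : basic_perp a a <-> a = basic_bot.
Proof.
by split=> [/lperpxx a0|->]; [apply: basic_elt_inj|apply/lperpxx].
Qed.

Fact basic_perp0x a : basic_perp basic_bot a.
Proof. exact: lperp0x. Qed.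

HB.instance Definition _ :=
  isOrthoset.Build basic_elt basic_perp_sym basic_perpxx basic_perp0x.

Hypothesis atomL : atomistic L.

Lemma atomistic_leP (x y : L) :
  (forall a, basic a -> a <= x -> a <= y) <-> x <= y.
Proof.
split=> [xy|xy a _ /le_trans]; last exact.
have [A [Aatom [Ax]]] := atomL x; apply=> a Aa.
by apply: xy; [left; apply: Aatom|apply: Ax].
Qed.

Lemma basic_frechet : frechet basic_elt.
Proof.
move=> [x bx] [y by_] x0 y0 xy.
have {}x0 : x <> \bot by move=> e; apply/x0/basic_elt_inj.
have {}y0 : y <> \bot by move=> e; apply/y0/basic_elt_inj.
have {}xy : x <> y by move=> e; apply/xy/basic_elt_inj.
(* If no basic element separates [x] from [y], atomisticity gives [ocompl x <= ocompl y], hence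
   [y <= x], which is impossible for distinct atoms. *)
apply: contra_notP x0 => nz.
have yx : y <= x.
  rewrite -(ocomplK x) -(ocomplK y); apply: le_ocompl.
  apply/atomistic_leP => a ba ax.
  by apply: contra_notP nz => nay; exists (exist _ a ba).
by case: (bx) => // -[_ /(_ y yx)[/y0//|yx']]; case: xy.
Qed.

Definition basic_below (l : L) : set basic_elt := [set a | sval a <= l].

(** By atomisticity, [a] is orthogonal to [l] as soon as it is orthogonal to every basic element
    below [l]. Applying this twice shows that [basic_below l] is closed. *)
Lemma orthocomp_basic_below l :
  orthocomp (basic_below l) = basic_below (ocompl l).
Proof.
apply/seteqP; split=> a /= al; last first.
  by move=> b bl; apply: le_trans al _; apply: le_ocompl.
apply: lperp_sym; apply/atomistic_leP => b bb bl.
exact/lperp_sym/(al (exist _ b bb)).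
Qed.

Fact basic_below_closed l : biorth (basic_below l) == basic_below l.
Proof.
by apply/eqP; rewrite /biorth !orthocomp_basic_below ocomplK.
Qed.

Definition basic_down l : orthoclosed basic_elt :=
  Orthoclosed (basic_below_closed l).

Lemma basic_down_point (a : basic_elt) : basic_down (sval a) = point a.
Proof.
apply/le_anti/andP; split; last by apply/point_le; apply: lexx.
apply/orthoclosed_leP => b /= ba c /(_ a erefl) ca.
exact: le_trans ba (lperp_sym ca).
Qed.

End BasicOrthoset.

(** * Suprema of closed sets of basic elements, and the inverse map *)

Section BasicSup.
Variable L : completeOrtholatticeType ortho_display.
Hypothesis atomL : atomistic L.

Definition basic_sup (A : orthoclosed (basic_elt L)) : L :=
  projT1 (cid (ex_supremum [set sval a | a in orthoclosed_set A])).

Lemma basic_sup_le A l :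
  basic_sup A <= l <-> forall a, orthoclosed_set A a -> sval a <= l.
Proof.
rewrite /basic_sup; case: cid => s /= [ub lub]; split=> [sl a Aa|Al].
  by apply: le_trans sl; apply: ub; exists a.
by apply: lub => _ [a Aa <-]; apply: Al.
Qed.

(** Both relations say that every member of [A] lies below [ocompl l]. *)
Lemma basic_sup_adjoint :
  is_adjoint (basic_sup : orthoset_of _ -> orthoset_of _) (basic_down atomL).
Proof.
move=> A l; rewrite /perp/= /lperp basic_sup_le.
split=> [Al|/orthoclosed_leP Al a /Al/=]; last by rewrite orthocomp_basic_below.
by apply/orthoclosed_leP => a /= /Al; rewrite orthocomp_basic_below.
Qed.

Lemma basic_downK : cancel (basic_down atomL) basic_sup.
Proof.
move=> l; apply/le_anti/andP; split; first by apply/basic_sup_le => a.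
apply/(atomistic_leP atomL) => a ba al.
have /basic_sup_le := lexx (basic_sup (basic_down atomL l)).
by move/(_ (exist _ a ba)); apply.
Qed.

Lemma basic_supK : cancel basic_sup (basic_down atomL).
Proof.
(* On complements the claim reads: [a] is orthogonal to the supremum of [A] exactly when it is
   orthogonal to each member. *)
move=> A; apply: orthocomp_inj; rewrite orthocomp_basic_below//.
apply/seteqP; split=> a /= aA.
  move=> b Ab; apply: le_trans aA _; apply: le_ocompl.
  by have /basic_sup_le := lexx (basic_sup A); apply.
by apply: lperp_sym; apply/basic_sup_le => b /aA/lperp_sym.
Qed.

Lemma basic_sup_point a : basic_sup (point a) = sval a.
Proof. by rewrite -(basic_down_point atomL) basic_downK. Qed.

Lemma basic_sup_caol : caol_map basic_sup.
Proof.
have frX := basic_frechet atomL; split.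
- by exists (basic_down atomL); apply: basic_sup_adjoint.
- by move=> A /(basicP frX)[a ->]; rewrite basic_sup_point; case: a.
- rewrite (ladjointE basic_sup_adjoint) => a ba.
  apply/(basicP frX); exists (exist _ a ba).
  by rewrite -(basic_down_point atomL).
Qed.

End BasicSup.

(** * Functoriality and the equivalence *)

Lemma C_dagger_functor (CatomP : forall X : fos_obj, atomistic (orthoclosed X))
    (CmapP : forall (X Y : fos_obj) (f : fos_hom X Y),
      caol_map (orthoclosed_map f)) :
  dagger_functor (C_obj CatomP) (C_hom CatomP CmapP).
Proof.
split=> [X|X Y Z g f|X Y f]; apply/caol_hom_inj => /=.
- apply/funext => A; apply/orthoclosed_inj.
  by rewrite /= image_id orthoclosedE.
(* The inner closure in the composite is absorbed by the outer one. *)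
- apply/funext => A /=.
  rewrite [RHS](orthoclosed_map_closure (adjointP (fos_adjointable g))).
  by rewrite image_comp.
- by rewrite ladjoint_orthoclosed_map//; apply: fos_adjointable.
Qed.

Theorem theorem6p9 :
  exists (CatomP : forall X : fos_obj, atomistic (orthoclosed X))
         (CmapP : forall (X Y : fos_obj) (f : fos_hom X Y),
                    caol_map (orthoclosed_map f)),
    dagger_functor (C_obj CatomP) (C_hom CatomP CmapP) /\
    dagger_equivalence (C_obj CatomP) (C_hom CatomP CmapP).
Proof.
exists (fun X => orthoclosed_atomistic (@fos_frechet X)), orthoclosed_map_caol.
have F := C_dagger_functor (fun X => orthoclosed_atomistic (@fos_frechet X))
  orthoclosed_map_caol.
split=> //; split=> // [X Y h|X Y f f' ff'|L].
- have [f [fP fh]] := caol_map_orthoclosed_map (@fos_frechet X)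
    (@fos_frechet Y) (caol_homP h).
  by exists (FosHom fP); apply: caol_hom_inj.
(* Faithfulness: the image of [point x] is [point (f x)], which determines [f x]. *)
- apply/fos_homP/funext => x; apply: (point_inj (@fos_frechet Y)).
  have Cff' : orthoclosed_map (f : fos_hom X Y) =
              orthoclosed_map (f' : fos_hom X Y) := congr1 (@caol_fun _ _) ff'.
  rewrite -(orthoclosed_map_point (adjointP (fos_adjointable f))).
  by rewrite -(orthoclosed_map_point (adjointP (fos_adjointable f'))) Cff'.
- have atomL := @caol_atomistic L.
  exists (FosObj (basic_frechet atomL)).
  exists (@CaolHom (CaolObj (orthoclosed_atomistic (basic_frechet atomL))) L _
    (basic_sup_caol atomL)).
  (* Unitarity holds because the adjoint [basic_down] of [basic_sup] is also its two-sided
     inverse. *)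
  split; apply/caol_hom_inj/funext => A /=;
    rewrite (ladjointE (basic_sup_adjoint atomL)) /=.
    exact: basic_supK.
  exact: basic_downK.
Qed.
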